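(* For every $n\ge1$ and every pattern $\sigma\in\mathfrak{S}_3$, the number of $3$-arrangements $\mathfrak{a}$ of $[n]$ whose permutation form $\mathrm{pf}_3(\mathfrak{a})$ avoids $\sigma$ equals $C(n+2)-2^n$, where $C(j)=\frac{1}{j+1}\binom{2j}{j}$ is the $j$-th Catalan number.
   Context: $\mathfrak{S}_n$ is the set of permutations of $[n]=\{1,\dots,n\}$; $\mathrm{FIX}(\pi)=\{i:\pi(i)=i\}$. A $3$-arrangement of $[n]$ is a pair $\mathfrak{a}=(\pi,\phi)$ with $\pi\in\mathfrak{S}_n$ and $\phi:\mathrm{FIX}(\pi)\to\{-1,-2,-3\}$ arbitrary. The permutation form $\mathrm{pf}_3(\mathfrak{a})$ is obtained from $\pi(1)\cdots\pi(n)$ by replacing $\pi(i)$ with $\phi(i)$ for each $i\in\mathrm{FIX}(\pi)$ with $\phi(i)\neq-3$, and then replacing every occurrence of the $j$-th smallest positive letter by $j$, for all $j$. For an integer word $w$, $\mathrm{red}(w)$ replaces every occurrence of the $j$-th smallest letter of $w$ by $j$. A word $w=w_1\cdots w_n$ avoids $\sigma\in\mathfrak{S}_3$ if there are no $i_1<i_2<i_3$ with $\mathrm{red}(w_{i_1}w_{i_2}w_{i_3})=\sigma$. *)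

(* Defs.v *)
From mathcomp Require Import all_boot all_order all_algebra all_fingroup.
Set Implicit Arguments. Unset Strict Implicit. Unset Printing Implicit Defensive.
Import Order.TTheory GRing.Theory Num.Theory.

(* [n] = {1..n} is modelled by 'I_n = {0..n-1}; element i : 'I_n stands for i+1. *)

(* A 3-arrangement (pi, phi) with phi : FIX(pi) -> {-1,-2,-3} is encoded as a
   pair (p, f) with p : 'S_n and f : {ffun 'I_n -> 'I_3}, where f i = k encodes
   phi(i) = -(k+1), and f is normalised to 0 outside FIX(p) (so f carries no
   information there).  This is a bijective encoding of 3-arrangements. *)
Definition arrangement n : finType := ('S_n * {ffun 'I_n -> 'I_3})%type.

Definition valid_arr n (a : arrangement n) : bool :=
  [forall i : 'I_n, (a.1 i != i) ==> (a.2 i == ord0)].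

Definition phival (k : 'I_3) : int := (- (Posz k.+1))%R.

Definition raw_word n (a : arrangement n) : seq int :=
  [seq (if (a.1 i == i) && (phival (a.2 i) != (- Posz 3)%R) then phival (a.2 i)
        else Posz (a.1 i).+1) | i <- enum 'I_n].

Definition std_pos (w : seq int) : seq int :=
  [seq (if (0 < x)%R then Posz (size (undup [seq y <- w | (0 < y)%R && (y <= x)%R]))
        else x) | x <- w].

Definition pf3 n (a : arrangement n) : seq int := std_pos (raw_word a).

Definition red (w : seq int) : seq nat :=
  [seq size (undup [seq y <- w | (y <= x)%R]) | x <- w].

Definition patword (s : 'S_3) : seq nat :=
  [seq (s i).+1 | i <- enum 'I_3].

Definition avoids (w : seq int) (s : 'S_3) : bool :=
  ~~ [exists i1 : 'I_(size w), exists i2 : 'I_(size w), exists i3 : 'I_(size w),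
        [&& i1 < i2, i2 < i3 &
            red [:: nth 0%R w i1; nth 0%R w i2; nth 0%R w i3] == patword s]].

Definition catalan (j : nat) : nat := 'C(j.*2, j) %/ j.+1.

(* Main.v *)
(** In pf_3 the letter -2 is the smallest, -1 the next one, and the positive letters form a
    permutation of [m]; so 3-arrangements are the same thing as permutations of the multisets
    {(-2)^i, (-1)^j, 1, ..., m} with i + j + m = n.

    Read a word from left to right and let mu be the minimum so far.  The next letter may be any
    remaining letter at most mu; a letter above mu creates an ascent from mu, and then avoiding
    123 (resp. 132) forces it to be the largest (resp. smallest) remaining letter above mu.
    Either way there is one choice, so 123 and 132 have the same number of avoiders on every
    multiset (Simion-Schmidt).  Reversing words and negating letters then identifies all six
    patterns.

    This common number depends only on the remaining letters at most mu and on the number u of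
    those above it.  Summing over contents, the total Z(n, u) satisfies
    Z(n, u) = Z(n, u-1) + Z(n-1, u+1) + D(n, u) with D made of partial sums of binomial
    coefficients.  This has a closed form, and Z(n, 0) = C(n+2) - 2^n. *)
Require Import Defs.
From mathcomp Require Import all_boot all_order all_algebra all_fingroup.
From mathcomp Require Import zify.
Set Implicit Arguments. Unset Strict Implicit. Unset Printing Implicit Defensive.
Import Order.TTheory GRing.Theory Num.Theory.

(** * Left-to-right generation of avoiders *)

Section Automaton.
Context {d : Order.disp_t} {T : orderType d}.
Local Open Scope order_scope.
Implicit Types (mu : T).

(* [mu] is the minimum of the letters already read; [r] is [>=] for 123 and [<=] for 132. *)
Fixpoint accepts (r : rel T) mu (w : seq T) :=
  if w is x :: w' then
    if x <= mu then accepts r x w' else all (fun y => (mu < y) ==> r x y) w' && accepts r mu w'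
  else true.

(* [L] is the multiset of remaining letters at most the current minimum, [u] the number of
   remaining letters above it, and [n] is fuel, to be taken equal to [size L + u]. *)
Fixpoint completions (n : nat) (L : seq T) (u : nat) : nat :=
  if n is n'.+1 then
    ((0 < u) * completions n' L u.-1
     + \sum_(y <- undup L)
         completions n' [seq z <- rem y L | (z <= y)%O] (u + count (fun z => (y < z)%O) L))%N
  else 1%N.

Lemma count_permutations_cons (U : eqType) (P : pred (seq U)) (R : seq U) :
  (0 < size R)%N ->
  count P (permutations R) =
  (\sum_(x <- undup R) count (fun w => P (x :: w)) (permutations (rem x R)))%N.
Proof.
move=> R0; set S := [seq x :: t | x <- undup R, t <- permutations (rem x R)].
have -> : count P (permutations R) = count P S.
  exact/seq.permP/permutationsE.
rewrite /S count_flatten sumnE !big_map; apply: eq_bigr => x _.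
by rewrite count_map.
Qed.

Lemma filter_rem (U : eqType) (P : pred U) x (R : seq U) :
  filter P (rem x R) = if P x then rem x (filter P R) else filter P R.
Proof.
elim: R => [|y R IH] /=; first by case: ifP.
have [->|yx] := eqVneq y x; first by case: (P x) => //=; rewrite eqxx.
rewrite /= IH; case: (P y); case: (P x) => //=.
by rewrite (negbTE yx).
Qed.

Lemma total_mem_all (U : eqType) (r : rel U) (S : seq U) :
  total r -> transitive r -> (0 < size S)%N ->
  exists2 x, x \in S & all (r x) S.
Proof.
move=> rtot rtr; elim: S => [//|x [|y S] IH] _.
  by exists x; rewrite ?mem_head //= andbT -[r x x]orbb rtot.
have [//|z zS zm] := IH; have [xz|zx] := orP (rtot x z).
  exists x; rewrite ?mem_head //= -[r x x]orbb rtot /=.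
  by apply: sub_all zm => t; apply: rtr.
exists z; first by rewrite in_cons zS orbT.
by apply/andP; split.
Qed.

(* The recursion [completions] does not mention [r]: a letter above [mu] must be the
   [r]-extremal one among the remaining letters above [mu], so there is
   exactly one choice for it, whatever [r]. *)
Lemma count_accepts (r : rel T) n mu (R : seq T) :
  total r -> antisymmetric r -> transitive r -> size R = n ->
  count (accepts r mu) (permutations R) =
  completions n [seq x <- R | x <= mu] (count (fun y => mu < y) R).
Proof.
move=> rtot ras rtr; elim: n mu R => [|n IH] mu R sR.
  by rewrite (size0nil sR).
rewrite count_permutations_cons ?sR // (bigID (fun x => x <= mu)) /= addnC.
congr addn.
- rewrite -big_filter filter_undup.
  set U := [seq x <- R | ~~ (x <= mu)].
  have cU : count (fun y => mu < y) R = size U.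
    by rewrite size_filter; apply: eq_count => x; rewrite /= ltNge.
  rewrite cU; case: (posnP (size U)) => [U0|Upos].
    by rewrite (size0nil U0) big_nil.
  have [x xU xm] := total_mem_all rtot rtr Upos; rewrite mul1n.
  have xmu : ~~ (x <= mu) by move: xU; rewrite mem_filter => /andP[].
  have xR : x \in R by move: xU; rewrite mem_filter => /andP[].
  rewrite (bigD1_seq x) ?undup_uniq ?mem_undup //= big1_seq ?addn0.
    rewrite (negbTE xmu).
    transitivity (count (accepts r mu) (permutations (rem x R))).
      apply: eq_in_count => w; rewrite mem_permutations => /perm_mem ew.
      suff -> : all (fun y => (mu < y) ==> r x y) w by [].
      apply/allP => y; rewrite ew => /mem_rem yR; apply/implyP => muy.
      by apply: (allP xm); rewrite mem_filter -ltNge muy.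
    rewrite IH; last by rewrite size_rem // sR.
    by rewrite -cU filter_rem (negbTE xmu) -!size_filter filter_rem
      ltNge xmu size_rem // mem_filter ltNge xmu.
  move=> y /andP[nyx]; rewrite mem_undup => yU.
  have ymu : ~~ (y <= mu) by move: yU; rewrite mem_filter => /andP[].
  (* Any other first letter y above [mu] is rejected: x comes later, so acceptance would give
     [r y x], and with [r x y] antisymmetry forces y = x. *)
  rewrite (negbTE ymu); apply/eqP; rewrite -leqn0 leqNgt -has_count -all_predC.
  apply/allP => w; rewrite mem_permutations => /perm_mem ew /=.
  have nxy : x != y by rewrite eq_sym.
  apply: contra nyx => /andP[/allP/(_ x) h _].
  apply/eqP/ras/andP; split; last exact: (allP xm).
  by move: h; rewrite ew ltNge xmu; apply; apply: rem_mem.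
rewrite -big_filter filter_undup; apply: eq_big_seq => x.
rewrite mem_undup mem_filter => /andP[xmu xR].
rewrite xmu IH ?size_rem ?sR //.
congr completions.
  rewrite filter_rem lexx filter_rem lexx -filter_predI.
  by congr rem; apply: eq_filter => z /=; case: (leP z x) => //= /le_trans ->.
(* The letters above the new minimum x are those above [mu] together with those strictly between x
   and [mu] or equal to [mu]. *)
rewrite !count_rem ltxx !andbF !subn0 count_filter.
elim: (R) => //= y s ->; rewrite [in RHS]leNgt.
by case: (ltP mu y) => [/(le_lt_trans xmu) ->|_] /=; lia.
Qed.

Definition avoids3_spec (P : T -> T -> T -> bool) (w : seq T) :=
  forall x y z, subseq [:: x; y; z] w -> ~~ P x y z.

Lemma subseq2_cons (x y a : T) (w : seq T) :
  subseq [:: x; y] (a :: w) <-> (x = a /\ y \in w) \/ subseq [:: x; y] w.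
Proof.
rewrite -sub1seq [subseq _ (a :: w)]/=; case: eqP => [->|nxa]; split; try tauto.
by case=> [[] //|]; apply: (subseq_trans (subseq_cons _ _)).
Qed.

Lemma subseq3_cons (x y z a : T) (w : seq T) :
  subseq [:: x; y; z] (a :: w) <->
  (x = a /\ subseq [:: y; z] w) \/ subseq [:: x; y; z] w.
Proof.
rewrite [subseq _ (a :: w)]/=; case: eqP => [->|nxa]; split; try tauto.
by case=> [[] //|]; apply: (subseq_trans (subseq_cons _ _)).
Qed.

(** Remembering the minimum suffices: if some earlier letter lies below both y and z, so does the
    minimum. The two clauses together say that [mu :: w] has no forbidden triple. *)
Lemma acceptsP (r : rel T) mu (w : seq T) :
  accepts r mu w <->
  avoids3_spec (fun x y z => [&& x < y, x < z & ~~ r y z]) w /\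
  (forall y z, subseq [:: y; z] w -> mu < y -> mu < z -> r y z).
Proof.
elim: w mu => [|a w IH] mu; first by split.
rewrite /=; case: leP => [amu|mua].
  rewrite IH; split=> [[av pr]|[av pr]]; split.
  - move=> x y z /subseq3_cons[[-> yz]|]; last exact: av.
    by apply/negP => /and3P[ay az]; rewrite pr.
  - move=> y z /subseq2_cons[[-> _]|yz] muy muz; first by rewrite ltNge amu in muy.
    by apply: pr yz _ _; apply: le_lt_trans amu _.
  - by move=> x y z xyz; apply: av; apply/subseq3_cons; right.
  - move=> y z yz ay az.
    have /av : subseq [:: a; y; z] (a :: w) by apply/subseq3_cons; left.
    by rewrite ay az negbK.
split=> [/andP[/allP al /IH[av pr]]|[av pr]].
  split=> [x y z|y z].
    move=> /subseq3_cons[[-> yz]|]; last exact: av.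
    by apply/negP => /and3P[ay az]; rewrite pr ?(lt_trans mua).
  by move=> /subseq2_cons[[-> /al/implyP zw] _|]; last exact: pr.
apply/andP; split.
  apply/allP => y yw; apply/implyP => muy; apply: pr => //.
  by apply/subseq2_cons; left.
apply/IH; split=> [x y z xyz|y z yz]; first by apply: av; apply/subseq3_cons; right.
by apply: pr; apply/subseq2_cons; right.
Qed.

Definition state_count (L : seq T) u := completions (size L + u) L u.

(* The part of [state_count L u] where the next letter is taken from [L]. *)
Definition low_first (L : seq T) u :=
  (\sum_(y <- undup L)
    completions (size L + u).-1 [seq z <- rem y L | (z <= y)%O]
      (u + count (fun z => (y < z)%O) L))%N.

Lemma state_count_nil u : state_count [::] u = 1%N.
Proof. by rewrite /state_count; elim: u => //= u; rewrite big_nil mul1n addn0. Qed.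

Lemma state_count_rec L u : (0 < size L + u)%N ->
  state_count L u = ((0 < u) * state_count L u.-1 + low_first L u)%N.
Proof.
rewrite /state_count /low_first; case: u => [|u]; first by rewrite addn0; case: (size L).
by rewrite addnS.
Qed.

Lemma state_count_recS L u : state_count L u.+1 = (state_count L u + low_first L u.+1)%N.
Proof. by rewrite state_count_rec ?addnS // mul1n. Qed.

(* Starting with a letter below [x] moves the whole block of [x] above the minimum. *)
Lemma low_first_block x j L u : all (fun y => y < x) L ->
  low_first (nseq j.+1 x ++ L) u = (state_count (nseq j x ++ L) u + low_first L (u + j.+1))%N.
Proof.
move=> /allP Lx; have xL : x \notin L by apply/negP => /Lx; rewrite ltxx.
have U : undup (nseq j.+1 x ++ L) = x :: undup L.
  elim: j => [|j IH]; first by rewrite /= (negbTE xL).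
  rewrite -[RHS]IH -[nseq j.+2 x ++ L]/(x :: (nseq j.+1 x ++ L)).
  by rewrite [LHS]/= mem_head.
rewrite {1}/low_first U big_cons size_cat size_nseq; congr addn.
  rewrite /= eqxx /state_count size_cat size_nseq; congr completions.
    apply/all_filterP; rewrite all_cat all_nseq lexx orbT; apply/allP => y /Lx.
    exact: ltW.
  rewrite ltxx count_cat count_nseq ltxx add0n.
  rewrite (@eq_in_count _ _ pred0) ?count_pred0 ?addn0 // => y /Lx /ltW.
  by rewrite leNgt => /negbTE.
rewrite /low_first; apply: eq_big_seq => y; rewrite mem_undup => yL.
have yx := Lx _ yL; congr completions; first by lia.
  rewrite !filter_rem lexx filter_cat (_ : filter _ (nseq _ _) = [::]) //.
  by elim: j.+1 => //= k ->; rewrite leNgt yx.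
by rewrite count_cat count_nseq yx; lia.
Qed.

End Automaton.

(** * Counting by content *)

(** The decreasing order puts each block of equal letters in front of the smaller ones, as
    [low_first_block] requires. *)
Definition letters (i j m : nat) : seq int :=
  rev [seq Posz k | k <- iota 1 m] ++ nseq j (- 1)%R ++ nseq i (- 2)%R.

Definition content_count i j m u := state_count (letters i j m) u.

Lemma lettersS i j m : letters i j m.+1 = Posz m.+1 :: letters i j m.
Proof.
rewrite /letters (_ : iota 1 m.+1 = rcons (iota 1 m) m.+1) ?map_rcons ?rev_rcons //.
by rewrite -cats1 -(iotaD 1 m 1) addn1.
Qed.

Lemma letters_bound i j m : all (fun y => (y < Posz m.+1)%R) (letters i j m).
Proof.
rewrite /letters !all_cat all_rev !all_nseq !orbT !andbT all_map.
by apply/allP => k; rewrite mem_iota /=; lia.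
Qed.

(** Reading m+1 removes it, and reading a smaller letter moves it above the minimum. By
    [state_count_recS] the two cases add up to the state without m+1 and with one more letter
    above. *)
Lemma content_count_top0 i j m : content_count i j m.+1 0 = content_count i j m 1.
Proof.
by rewrite /content_count state_count_rec lettersS // mul0n
  (low_first_block 0 _ (letters_bound i j m)) state_count_recS.
Qed.

Lemma content_count_topS i j m u :
  content_count i j m.+1 u.+1 = content_count i j m.+1 u + content_count i j m u.+2.
Proof.
rewrite /content_count state_count_recS; congr addn.
by rewrite lettersS (low_first_block 0 _ (letters_bound i j m)) addn1 -state_count_recS.
Qed.

Lemma low_first_bottom i v :
  low_first (letters i 0 0) v = (0 < i) * content_count i.-1 0 0 v.
Proof.
case: i => [|i]; first by rewrite /low_first big_nil.
by rewrite /content_count /letters /= mul1n -[_ :: _](cats0 (nseq i.+1 (-2)%R))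
  low_first_block //= cats0 /low_first big_nil addn0.
Qed.

Lemma content_count_nil u : content_count 0 0 0 u = 1.
Proof. exact: state_count_nil. Qed.

Lemma content_count_bottomS i u :
  content_count i.+1 0 0 u.+1 = content_count i.+1 0 0 u + content_count i 0 0 u.+1.
Proof. by rewrite /content_count state_count_recS low_first_bottom mul1n. Qed.

Lemma content_count_bottom0 i : content_count i.+1 0 0 0 = content_count i 0 0 0.
Proof. by rewrite {1}/content_count state_count_rec // low_first_bottom mul1n. Qed.

(** The letters above the minimum come in forced order, so these words are the shuffles of u forced
    letters with i equal ones. *)
Lemma content_count_bottom i u : content_count i 0 0 u = 'C(u + i, i).
Proof.
elim: i u => [|i IHi] u; first by rewrite content_count_nil bin0.
elim: u => [|u IHu]; first by rewrite content_count_bottom0 IHi !binn.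
by rewrite content_count_bottomS IHi IHu addSnnS -addSnnS addSn binS addnS.
Qed.

(** Once a -2 is read, every -1 joins the letters above the minimum, and what remains is a shuffle
    with the other -2s; this is the binomial term. *)
Lemma low_first_neg1 i j v : low_first (letters i j.+1 0) v =
  content_count i j 0 v + (0 < i) * 'C(v + j.+1 + i.-1, i.-1).
Proof.
rewrite /letters /= low_first_block; last by rewrite all_nseq orbT.
by congr addn; rewrite -content_count_bottom -low_first_bottom.
Qed.

Lemma content_count_neg10 i j :
  content_count i j.+1 0 0 = content_count i j 0 0 + (0 < i) * 'C(j + i, i.-1).
Proof.
rewrite {1}/content_count state_count_rec; last by rewrite /letters /=.
by rewrite low_first_neg1 mul0n add0n; case: i => //= i; rewrite add0n addSnnS.
Qed.

Lemma content_count_neg1S i j u : content_count i j.+1 0 u.+1 =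
  content_count i j.+1 0 u + content_count i j 0 u.+1 + (0 < i) * 'C(u + j.+1 + i, i.-1).
Proof.
rewrite {1}/content_count state_count_recS low_first_neg1 addnA.
by case: i => //= i; rewrite !mul1n; congr addn; congr binomial; lia.
Qed.

(** * Summation over contents and the closed form *)

Definition bin_psum N k := \sum_(i < k) 'C(N, i).

(** Here k is the number of negative letters, of which i are -2. *)
Definition neg_sum m u k := \sum_(i < k.+1) content_count i (k - i) m u.

Definition grand_total n u := \sum_(k < n.+1) neg_sum (n - k) u k.

Lemma bin_psum0 N : bin_psum N 0 = 0.
Proof. exact: big_ord0. Qed.

Lemma bin_psumS N k : bin_psum N k.+1 = bin_psum N k + 'C(N, k).
Proof. exact: big_ord_recr. Qed.

Lemma bin_psum_pascal N k : bin_psum N.+1 k.+1 = bin_psum N k.+1 + bin_psum N k.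
Proof.
elim: k => [|k IH]; first by rewrite !bin_psumS !bin_psum0 !bin0.
by rewrite bin_psumS IH !bin_psumS binS; lia.
Qed.

Lemma bin_psum_full N k : N < k -> bin_psum N k = 2 ^ N.
Proof.
elim: k N => // k IH [_|N].
  by rewrite /bin_psum big_ord_recl big1 // => i _; rewrite bin0n.
rewrite ltnS => Nk; rewrite bin_psum_pascal bin_psumS bin_small // IH // expnS; lia.
Qed.

Lemma neg_sum00 u : neg_sum 0 u 0 = 1.
Proof. by rewrite /neg_sum big_ord1 content_count_nil. Qed.

Lemma neg_sum0_0S k : neg_sum 0 0 k.+1 = neg_sum 0 0 k + bin_psum k k.+1.
Proof.
rewrite /neg_sum big_ord_recr /= subnn content_count_bottom0.
transitivity (\sum_(i < k.+1) (content_count i (k - i) 0 0 + (0 < i) * 'C(k, i.-1))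
  + content_count k 0 0 0).
  congr addn; apply: eq_bigr => i _; have ik : i <= k by rewrite -ltnS.
  by rewrite subSn // content_count_neg10 subnK.
rewrite big_split /= -addnA; congr addn.
rewrite big_ord_recl mul0n add0n content_count_bottom add0n binn.
rewrite bin_psumS binn; congr addn.
by apply: eq_bigr => i _; rewrite /= mul1n.
Qed.

(** The content without -1 follows the recurrence for -2 alone, the others the one for -1. The
    binomials of the latter form a partial sum, which the leftover [content_count k 0 0 u.+1]
    completes. *)
Lemma neg_sum0_SS u k :
  neg_sum 0 u.+1 k.+1 = neg_sum 0 u k.+1 + neg_sum 0 u.+1 k + bin_psum (u + k.+1) k.+1.
Proof.
rewrite /neg_sum big_ord_recr /= subnn content_count_bottomS
  [\sum_(i < k.+2) _]big_ord_recr /= subnn.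
transitivity (\sum_(i < k.+1) (content_count i (k.+1 - i) 0 u + content_count i (k - i) 0 u.+1
    + (0 < i) * 'C(u + k.+1, i.-1))
  + (content_count k.+1 0 0 u + content_count k 0 0 u.+1)).
  congr addn; apply: eq_bigr => i _; have ik : i <= k by rewrite -ltnS.
  by rewrite subSn // content_count_neg1S; congr (_ + _ * 'C(_, _)); lia.
rewrite !big_split /= [\sum_(i < k.+1) ((0 < i) * _)]big_ord_recl mul0n add0n.
rewrite (_ : \sum_(i < k) _ = bin_psum (u + k.+1) k); last first.
  by apply: eq_bigr => i _; rewrite /= mul1n.
by rewrite bin_psumS (content_count_bottom k) addSnnS; lia.
Qed.

(** By Pascal's rule for partial sums the right-hand side satisfies the recurrence [neg_sum0_SS]; at
    u = 0 both sides are 2^k. *)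
Lemma neg_sum0E u k : neg_sum 0 u k = u * bin_psum (u + k) k + bin_psum (u + k) k.+1.
Proof.
elim: k u => [|k IHk] u; first by rewrite neg_sum00 bin_psumS bin_psum0 bin0 muln0.
elim: u => [|u IHu].
  by rewrite neg_sum0_0S IHk !add0n !bin_psum_full // expnS; lia.
rewrite neg_sum0_SS IHu IHk !addSn !addnS !bin_psum_pascal.
lia.
Qed.

Lemma grand_total0 u : grand_total 0 u = 1.
Proof. by rewrite /grand_total big_ord1 neg_sum00. Qed.

Lemma neg_sum_top0 m k : neg_sum m.+1 0 k = neg_sum m 1 k.
Proof. by apply: eq_bigr => i _; rewrite content_count_top0. Qed.

Lemma neg_sum_topS m u k : neg_sum m.+1 u.+1 k = neg_sum m.+1 u k + neg_sum m u.+2 k.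
Proof. by rewrite -big_split; apply: eq_bigr => i _; rewrite content_count_topS. Qed.

Lemma grand_total_S0 n : grand_total n.+1 0 = neg_sum 0 0 n.+1 + grand_total n 1.
Proof.
rewrite /grand_total big_ord_recr /= subnn addnC; congr addn.
by apply: eq_bigr => k _; rewrite subSn -1?ltnS // neg_sum_top0.
Qed.

(** [neg_sum_topS] applies to every summand except k = n+1, where no positive letter is left. Its
    two values, whose difference is D, stand on opposite sides to avoid subtraction. *)
Lemma grand_total_SS n u :
  grand_total n.+1 u.+1 + neg_sum 0 u n.+1 =
  grand_total n.+1 u + grand_total n u.+2 + neg_sum 0 u.+1 n.+1.
Proof.
rewrite /grand_total big_ord_recr [\sum_(k < n.+2) neg_sum (n.+1 - k) u k]big_ord_recr /= subnn.
rewrite (eq_bigr (fun k : 'I_n.+1 => neg_sum (n.+1 - k) u k + neg_sum (n - k) u.+2 k)).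
  by rewrite big_split /=; lia.
by move=> k _; rewrite subSn -1?ltnS // neg_sum_topS.
Qed.

(* The two binomials with top [2n + u + 4] form the ballot-number solution of the homogeneous
   recurrence; the other terms are a particular solution, all moved to the left-hand side so
   that no subtraction occurs. *)
Lemma grand_totalE n u :
  grand_total n u + u * bin_psum (n + u) n.+1 + bin_psum (n + u) n.+3 + 'C(n + u, n.+1)
    + 'C(n.*2 + u + 4, n.+1) = 'C(n.*2 + u + 4, n.+2).
Proof.
elim: n u => [|n IHn] u.
  rewrite grand_total0 add0n !bin_psumS bin_psum0 !bin0 !bin1 add0n addn4 !binS !bin0 !bin1.
  lia.
elim: u => [|u IHu].
  rewrite grand_total_S0 neg_sum0E !mul0n !add0n !addn0 (bin_small (ltnSn n.+1)).
  rewrite [bin_psum _ n.+2]bin_psum_full // [bin_psum _ n.+4]bin_psum_full; last by lia.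
  have := IHn 1; have := bin_psum_full (ltnSn n.+1); rewrite addn1 bin_psumS binn mul1n.
  rewrite [bin_psum _ n.+3]bin_psum_full // doubleS addn1 !addSn !binS.
  (* The two middle entries of the odd row 2n+5 agree; this makes the case u = 0 follow from [IHn]
     at u = 1. *)
  have : 'C((n.*2 + 4).+1, n.+3) = 'C((n.*2 + 4).+1, n.+2).
    by rewrite -bin_sub; [congr binomial; lia | lia].
  rewrite (_ : n.*2 + 1 + 4 = (n.*2 + 4).+1) ?binS; lia.
have := grand_total_SS n u; have := IHn u.+2; move: IHu; rewrite !neg_sum0E.
rewrite (_ : n.+1.*2 + u + 4 = n.*2 + u.+2 + 4); last by lia.
rewrite (_ : n.+1.*2 + u.+1 + 4 = (n.*2 + u.+2 + 4).+1); last by lia.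
rewrite !(binS (n.*2 + u.+2 + 4)); move: (n.*2 + _ + 4) => N.
rewrite (addnC u n.+1) (addnC u.+1 n.+1) !(addnS n.+1) !(addnS n) addSn.
move: (n + u).+1 => S; rewrite !bin_psum_pascal !bin_psumS !(binS S); lia.
Qed.

Lemma catalanE n : catalan n.+1 + 'C(n.+1.*2, n) = 'C(n.+1.*2, n.+1).
Proof.
have e : n.+2 * 'C(n.+1.*2, n) = n.+1 * 'C(n.+1.*2, n.+1).
  by rewrite mul_bin_left; congr muln; lia.
have le : 'C(n.+1.*2, n) <= 'C(n.+1.*2, n.+1).
  by rewrite -(leq_pmul2l (isT : 0 < n.+2)) e leq_mul2r leqnSn orbT.
have -> : catalan n.+1 = 'C(n.+1.*2, n.+1) - 'C(n.+1.*2, n).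
  rewrite /catalan; set a := 'C(_, n.+1) in e le *; set b := 'C(_, n) in e le *.
  (* The division is exact: (n+2) b = (n+1) a gives a = (n+2)(a - b). *)
  have -> : a = (a - b) * n.+2 by nia.
  by rewrite mulnK //; nia.
by rewrite subnK.
Qed.

Lemma grand_total_catalan n : grand_total n 0 = catalan n.+2 - 2 ^ n.
Proof.
have := grand_totalE n 0; have := catalanE n.+1.
rewrite mul0n !addn0 (bin_psum_full (_ : n < n.+3)) ?(bin_small (ltnSn n)) ?addn0; last by lia.
rewrite (_ : n.+2.*2 = n.*2 + 4); last by lia.
by lia.
Qed.

(** * Symmetries between the six patterns *)

Section Triples.
Context {d : Order.disp_t} {T : orderType d}.
Implicit Types (P : T -> T -> T -> bool) (w R : seq T).

(** A pattern is a predicate on three letters, so that reversing a word or mapping its letters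
    becomes an operation on [P]. *)
Fixpoint avoids3 P w :=
  if w is x :: w' then pairwise (fun y z => ~~ P x y z) w' && avoids3 P w' else true.

Lemma pairwise_subseqP (r : rel T) w :
  pairwise r w <-> forall y z, subseq [:: y; z] w -> r y z.
Proof.
split=> [rw y z yz|].
  by have := subseq_pairwise yz rw; rewrite /= !andbT.
elim: w => //= x w IH h; apply/andP; split.
  by apply/allP => y yw; apply: h; apply/subseq2_cons; left.
by apply: IH => y z yz; apply: h; apply/subseq2_cons; right.
Qed.

Lemma avoids3P P w : reflect (avoids3_spec P w) (avoids3 P w).
Proof.
apply: (iffP idP).
  elim: w => //= a w IH /andP[/pairwise_subseqP pw /IH av] x y z.
  by move=> /subseq3_cons[[-> /pw]|/av].
elim: w => //= a w IH av; apply/andP; split.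
  by apply/pairwise_subseqP => y z yz; apply: av; apply/subseq3_cons; left.
by apply: IH => x y z h; apply: av; apply/subseq3_cons; right.
Qed.

Lemma eq_avoids3 P Q w : (forall x y z, P x y z = Q x y z) -> avoids3 P w = avoids3 Q w.
Proof. by move=> e; apply/avoids3P/avoids3P => h x y z /h; rewrite e. Qed.

Lemma avoids3_rev P w : avoids3 P (rev w) = avoids3 (fun x y z => P z y x) w.
Proof.
by apply/avoids3P/avoids3P => h x y z; rewrite -subseq_rev ?revK => /h.
Qed.

Definition avoid_count P R := count (avoids3 P) (permutations R).

Lemma eq_avoid_count P Q R : (forall x y z, P x y z = Q x y z) -> avoid_count P R = avoid_count Q R.
Proof. by move=> e; apply: eq_count => w; apply: eq_avoids3. Qed.

Lemma avoid_count_rev P R : avoid_count P R = avoid_count (fun x y z => P z y x) R.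
Proof.
rewrite /avoid_count.
have -> : count (avoids3 P) (permutations R) = count (avoids3 P) (map rev (permutations R)).
  apply/seq.permP/uniq_perm; rewrite ?permutations_uniq //.
    by rewrite (map_inj_uniq (can_inj revK)) permutations_uniq.
  move=> w; rewrite -[w in RHS]revK (mem_map (can_inj revK)) !mem_permutations.
  by rewrite perm_sym perm_rev perm_sym.
by rewrite count_map; apply: eq_count => w; apply: avoids3_rev.
Qed.

Lemma avoid_count_order (r : rel T) R : total r -> antisymmetric r -> transitive r ->
  avoid_count (fun x y z => [&& (x < y)%O, (x < z)%O & ~~ r y z]) R = completions (size R) R 0.
Proof.
move=> rtot ras rtr; case: R => [|a R']; first by [].
set R := a :: R'.
(* The largest letter serves as initial minimum: nothing lies above it, so u = 0 and the second
   clause of [acceptsP] is void. *)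
have [mu _ bound] := total_mem_all (r := >=%O) ge_total ge_trans (isT : 0 < size R).
have -> : completions (size R) R 0 =
    completions (size R) [seq x <- R | (x <= mu)%O] (count (fun y => (mu < y)%O) R).
  rewrite (all_filterP bound) (_ : count _ R = 0) //.
  apply/eqP; rewrite -leqn0 leqNgt -has_count -all_predC.
  by apply: sub_all bound => x; rewrite /= -leNgt.
rewrite -(count_accepts mu rtot ras rtr erefl); apply: eq_in_count => w.
rewrite mem_permutations => wR; apply/avoids3P/idP => [av|/acceptsP[] //].
apply/acceptsP; split=> // y z yz muy; have /(allP bound) : y \in R.
  by rewrite -(perm_mem wR) (mem_subseq yz) ?mem_head.
by rewrite /= leNgt muy.
Qed.

End Triples.

Lemma avoids3_map (d d' : Order.disp_t) (T : orderType d) (T' : orderType d') (h : T -> T')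
    (P : T' -> T' -> T' -> bool) (w : seq T) :
  avoids3 P (map h w) = avoids3 (fun x y z => P (h x) (h y) (h z)) w.
Proof. by elim: w => //= x w ->; rewrite pairwise_map. Qed.

Lemma avoid_count_map (d d' : Order.disp_t) (T : orderType d) (T' : orderType d')
    (h : T -> T') (h' : T' -> T)
    (P : T' -> T' -> T' -> bool) (R : seq T) :
  cancel h h' -> cancel h' h ->
  avoid_count P (map h R) = avoid_count (fun x y z => P (h x) (h y) (h z)) R.
Proof.
move=> hK h'K; rewrite /avoid_count; have hI := can_inj hK.
have -> : count (avoids3 P) (permutations (map h R)) =
    count (avoids3 P) (map (map h) (permutations R)).
  apply/seq.permP/uniq_perm; rewrite ?permutations_uniq //.
    by rewrite (map_inj_uniq (inj_map hI)) permutations_uniq.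
  move=> w; rewrite -[w](mapK h'K) (mem_map (inj_map hI)) !mem_permutations.
  by apply/idP/idP => [/perm_map_inj|/perm_map]; apply.
by rewrite count_map; apply: eq_count => w; apply: avoids3_map.
Qed.

(** * The six patterns on integer words *)

Section IntegerPatterns.
Local Open Scope ring_scope.

Lemma avoid_count_123 (R : seq int) :
  avoid_count (fun x y z => x < y < z) R = completions (size R) R 0.
Proof.
rewrite -(@avoid_count_order _ _ >=%O); [|exact: ge_total|exact: ge_anti|exact: ge_trans].
apply: eq_avoid_count => x y z; rewrite /= -ltNge; case: (ltP y z) => [yz|]; rewrite ?andbF //.
by rewrite !andbT; case: (ltP x y) => //= /lt_trans ->.
Qed.

Lemma avoid_count_132 (R : seq int) :
  avoid_count (fun x y z => x < z < y) R = completions (size R) R 0.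
Proof.
rewrite -(@avoid_count_order _ _ <=%O); [|exact: le_total|exact: le_anti|exact: le_trans].
apply: eq_avoid_count => x y z; rewrite /= -ltNge; case: (ltP z y) => [yz|]; rewrite ?andbF //.
by rewrite !andbT andbC; case: (ltP x z) => //= /lt_trans ->.
Qed.

Lemma avoid_count_231 (R : seq int) :
  avoid_count (fun x y z => z < x < y) R = completions (size R) R 0.
Proof. by rewrite avoid_count_rev avoid_count_132. Qed.

Lemma avoid_count_321 (R : seq int) :
  avoid_count (fun x y z => z < y < x) R = completions (size R) R 0.
Proof. by rewrite avoid_count_rev avoid_count_123. Qed.

(** Negation turns 312 into 132 but also changes the multiset. On the negated multiset 132 and 123
    agree, and negating back turns 123 into 321 on [R]. *)
Lemma avoid_count_312 (R : seq int) :
  avoid_count (fun x y z => y < z < x) R = completions (size R) R 0.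
Proof.
transitivity (avoid_count (fun x y z : int => x < z < y) [seq - x | x <- R]).
  rewrite (avoid_count_map _ _ (@opprK int) (@opprK int)).
  by apply: eq_avoid_count => x y z; rewrite !ltrN2 andbC.
rewrite avoid_count_132 -avoid_count_123 (avoid_count_map _ _ (@opprK int) (@opprK int))
  -avoid_count_321.
by apply: eq_avoid_count => x y z; rewrite !ltrN2 andbC.
Qed.

Lemma avoid_count_213 (R : seq int) :
  avoid_count (fun x y z => y < x < z) R = completions (size R) R 0.
Proof. by rewrite avoid_count_rev avoid_count_312. Qed.

Lemma avoidsE w s : avoids w s = avoids3 (fun x y z => red [:: x; y; z] == patword s) w.
Proof.
rewrite /avoids; apply/idP/avoids3P => [av x y z|av].
  move=> /subseqP[m sm e]; apply: contra av => red_eq.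
  (* The positions that the mask selects, in increasing order, are the required indices. *)
  set t := mask m (iota 0 (size w)).
  have et : [:: x; y; z] = map (nth 0 w) t by rewrite e map_mask -/(mkseq _ _) mkseq_nth.
  have st : sorted ltn t by apply: (sorted_mask ltn_trans); apply: iota_ltn_sorted.
  have bt i : i \in t -> (i < size w)%N by move/mem_mask; rewrite mem_iota.
  case: t et st bt => [|i1 [|i2 [|i3 []]]] //= [ex ey ez] /and3P[l12 l23 _] bt.
  have [b1 b2 b3] : [/\ i1 < size w, i2 < size w & i3 < size w]%N.
    by split; apply: bt; rewrite !inE eqxx ?orbT.
  apply/existsP; exists (Ordinal b1); apply/existsP; exists (Ordinal b2).
  by apply/existsP; exists (Ordinal b3); rewrite /= l12 l23 -ex -ey -ez.
apply/existsP => -[i1 /existsP[i2 /existsP[i3 /and3P[l12 l23]]]]; apply/negP/av.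
set t : seq nat := [:: val i1; val i2; val i3].
rewrite -[X in subseq _ X](mkseq_nth 0); apply: (map_subseq _ (s1 := t)).
rewrite (_ : t = [seq i <- iota 0 (size w) | i \in t]) ?filter_subseq //.
apply: (irr_sorted_eq ltn_trans ltnn) => [||i].
- by rewrite /= l12 l23.
- exact/(sorted_filter ltn_trans)/iota_ltn_sorted.
rewrite mem_filter mem_iota add0n /=; case: (boolP (i \in _)) => //=.
by rewrite !inE => /or3P[] /eqP->; rewrite ltn_ord.
Qed.

(** Letters may repeat: a triple with a tie has a repeated entry in [red], so it matches no pattern,
    and every strict chain fails too. *)
Lemma red3 (x y z : int) :
  [/\ (red [:: x; y; z] == [:: 1; 2; 3]%N) = (x < y < z),
      (red [:: x; y; z] == [:: 1; 3; 2]%N) = (x < z < y) &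
      (red [:: x; y; z] == [:: 2; 1; 3]%N) = (y < x < z)] /\
  [/\ (red [:: x; y; z] == [:: 2; 3; 1]%N) = (z < x < y),
      (red [:: x; y; z] == [:: 3; 1; 2]%N) = (y < z < x) &
      (red [:: x; y; z] == [:: 3; 2; 1]%N) = (z < y < x)].
Proof.
rewrite /red /= !lexx.
have cmp (a b : int) : a < b -> (((a == b) = false) * ((b == a) = false)) *
    (((a <= b) = true) * ((b <= a) = false)) * (((a < b) = true) * ((b < a) = false)).
  by move=> ab; rewrite lt_eqF // gt_eqF // ltW // leNgt ab ltNge ltW.
case: (ltgtP x y) => [xy|xy|xy]; case: (ltgtP y z) => [yz|yz|yz];
  case: (ltgtP x z) => [xz|xz|xz]; try (exfalso; lia); try subst;
  repeat match goal with H : is_true (_ < _) |- _ =>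
    move: H => /cmp H; rewrite ?H /= ?inE ?H; clear H end;
  by rewrite /= ?inE ?eqxx ?ltxx ?lexx.
Qed.

Lemma patword_cases (s : 'S_3) : patword s \in
  [:: [:: 1; 2; 3]; [:: 1; 3; 2]; [:: 2; 1; 3]; [:: 2; 3; 1]; [:: 3; 1; 2]; [:: 3; 2; 1]]%N.
Proof.
pose o1 : 'I_3 := Ordinal (isT : 1 < 3)%N; pose o2 : 'I_3 := Ordinal (isT : 2 < 3)%N.
have -> : patword s = [:: (s ord0).+1; (s o1).+1; (s o2).+1].
  rewrite /patword -(eqP (_ : [:: ord0; o1; o2] == enum 'I_3)) //.
  by rewrite -(inj_eq (inj_map val_inj)) val_enum_ord.
have inj (i j : 'I_3) : i != j -> val (s i) != val (s j).
  by rewrite (inj_eq val_inj) (inj_eq perm_inj).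
move: (inj ord0 o1 isT) (inj ord0 o2 isT) (inj o1 o2 isT).
by case: (s ord0) (s o1) (s o2) =>
  [[|[|[|a]]] ?] [[|[|[|b]]] ?] [[|[|[|c]]] ?].
Qed.

Lemma count_avoids s (R : seq int) :
  count (avoids^~ s) (permutations R) = completions (size R) R 0.
Proof.
rewrite (eq_count (a2 := avoids3 (fun x y z => red [:: x; y; z] == patword s))); last first.
  by move=> w; rewrite /= avoidsE.
rewrite -/(avoid_count _ R).
have := patword_cases s; rewrite !inE => /or4P[|||/or3P[]] /eqP ->.
- by rewrite -avoid_count_123; apply: eq_avoid_count => x y z; case: (red3 x y z) => -[-> _ _].
- by rewrite -avoid_count_132; apply: eq_avoid_count => x y z; case: (red3 x y z) => -[_ -> _].
- by rewrite -avoid_count_213; apply: eq_avoid_count => x y z; case: (red3 x y z) => -[_ _ ->].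
- by rewrite -avoid_count_231; apply: eq_avoid_count => x y z; case: (red3 x y z) => _ [-> _ _].
- by rewrite -avoid_count_312; apply: eq_avoid_count => x y z; case: (red3 x y z) => _ [_ -> _].
- by rewrite -avoid_count_321; apply: eq_avoid_count => x y z; case: (red3 x y z) => _ [_ _ ->].
Qed.

End IntegerPatterns.

Lemma uniq_map_inj (T1 T2 : eqType) (h : T1 -> T2) (s : seq T1) :
  uniq (map h s) -> {in s &, injective h}.
Proof.
elim: s => //= x s IH /andP[xs us] y z; rewrite !inE.
move=> /predU1P[->|ys] /predU1P[->|zs] // e; last exact: IH e.
  by move: xs; rewrite e map_f.
by move: xs; rewrite -e map_f.
Qed.

(** * The permutation form as a bijection *)

Section Rank.
Variable n : nat.
Implicit Types (K P : pred 'I_n).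

(** For [K x] this is the rank of x within [K], counted from 1, hence the letter that
    standardization assigns. *)
Definition rk K (x : nat) := count (fun j : 'I_n => K j && (j <= x)) (enum 'I_n).

Lemma rk_lt K (x y : 'I_n) : K y -> x < y -> rk K x < rk K y.
Proof.
move=> Ky xy; rewrite /rk -addn1.
have -> : 1 = count (pred1 y) (enum 'I_n) by rewrite count_uniq_mem ?enum_uniq ?mem_enum.
rewrite -count_predUI [X in _ + X](_ : _ = 0) ?addn0.
  apply: sub_count => j /= /orP[/andP[-> jx]|/eqP->]; last by rewrite Ky /=.
  by rewrite (leq_trans jx) // ltnW.
apply/eqP; rewrite -leqn0 leqNgt -has_count; apply/hasPn => j _ /=.
by apply/negP => /andP[/andP[_ jx] /eqP e]; move: jx; rewrite e leqNgt xy.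
Qed.

Lemma rk_inj K (x y : 'I_n) : K x -> K y -> rk K x = rk K y -> x = y.
Proof.
move=> Kx Ky e; apply/val_inj.
by case: (ltngtP x y) => // [/(rk_lt Ky)|/(rk_lt Kx)]; rewrite e ltnn.
Qed.

Lemma rk_gt0 K (x : 'I_n) : K x -> 0 < rk K x.
Proof. by move=> Kx; rewrite -has_count; apply/hasP; exists x; rewrite ?mem_enum //= Kx /=. Qed.

(** The ranks are distinct and lie in an interval with equally many elements, so they fill it. *)
Lemma rk_perm K :
  perm_eq [seq rk K x | x : 'I_n <- [seq i <- enum 'I_n | K i]]
          (iota 1 (count K (enum 'I_n))).
Proof.
have u : uniq [seq rk K x | x : 'I_n <- [seq i <- enum 'I_n | K i]].
  rewrite map_inj_in_uniq; first exact/filter_uniq/enum_uniq.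
  move=> x y.
  by rewrite !mem_filter => /andP[Kx _] /andP[Ky _]; apply: rk_inj.
have [||_ h] := uniq_min_size u (s2 := iota 1 (count K (enum 'I_n))).
- move=> r /mapP[x]; rewrite mem_filter => /andP[Kx _] ->.
  rewrite mem_iota rk_gt0 //= add1n ltnS.
  by apply: sub_count => j /andP[].
- by rewrite size_iota size_map size_filter.
by apply: uniq_perm; rewrite ?iota_uniq.
Qed.

End Rank.

Section PermutationForm.
Variable n : nat.
Implicit Types (a b : arrangement n).
Local Open Scope ring_scope.

(* The positions whose letter stays positive: the non-fixed points and the fixed points with
   [phi = -3]. *)
Definition kept a : pred 'I_n :=
  fun i => ~~ ((a.1 i == i) && (phival (a.2 i) != - Posz 3)).

Definition pf3_letter a (i : 'I_n) : int :=
  if kept a i then Posz (rk (kept a) (a.1 i)) else phival (a.2 i).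

(** Fixed points and non-fixed points are each preserved, so the kept positions are also the kept
    values, and values can be ranked within [kept a]. *)
Lemma kept_perm a i : kept a (a.1 i) = kept a i.
Proof.
rewrite /kept; case: (eqVneq (a.1 i) i) => [e|ne]; first by rewrite !e eqxx.
by rewrite (inj_eq perm_inj) (negbTE ne).
Qed.

Lemma phival_lt0 k : phival k < 0. Proof. by rewrite /phival; lia. Qed.

Lemma count_perm (p : 'S_n) (P : pred 'I_n) :
  count (P \o p) (enum 'I_n) = count P (enum 'I_n).
Proof.
rewrite -count_map; apply/seq.permP/uniq_perm; rewrite ?enum_uniq //.
  by rewrite (map_inj_uniq perm_inj) enum_uniq.
by move=> i; rewrite mem_enum -[i](permKV p) (mem_map perm_inj) mem_enum.
Qed.

Lemma pf3E a : pf3 a = [seq pf3_letter a i | i <- enum 'I_n].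
Proof.
rewrite /pf3 /std_pos; set raw := raw_word a.
pose rl i : int := if kept a i then Posz (a.1 i).+1 else phival (a.2 i).
have rawE : raw = [seq rl i | i <- enum 'I_n].
  by apply: eq_map => i; rewrite /rl /kept; case: (_ && _).
have rl_gt0 i : (0 < rl i) = kept a i.
  by rewrite /rl; case: ifP => // _; apply/negbTE; rewrite -leNgt ltW ?phival_lt0.
rewrite rawE -map_comp; apply: eq_map => i /=.
rewrite /pf3_letter rl_gt0; case: ifP => [ki|nk]; last by rewrite /rl nk.
rewrite filter_map undup_id ?size_map.
  rewrite size_filter /rk; congr Posz; rewrite -[RHS](count_perm a.1); apply: eq_count => j /=.
  by rewrite kept_perm rl_gt0 /rl ki; case: (kept a j).
rewrite map_inj_in_uniq; first exact/filter_uniq/enum_uniq.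
move=> j k.
rewrite !mem_filter /= !rl_gt0 => /andP[/andP[kj _] _] /andP[/andP[kk _] _].
by rewrite /rl kj kk => -[] /val_inj/perm_inj.
Qed.

Lemma pf3_letter_gt0 a i : (0 < pf3_letter a i) = kept a i.
Proof.
rewrite /pf3_letter; case: ifP => ki; first by rewrite ltz_nat rk_gt0 ?kept_perm.
by apply/negbTE; rewrite -leNgt ltW ?phival_lt0.
Qed.

Lemma phival_inj : injective phival.
Proof. by move=> k l; rewrite /phival => e; apply: val_inj => /=; lia. Qed.

(** The signs of the letters give [kept]; there the ranks determine the permutation, and elsewhere
    it is the identity and the letter is the label. Labels at kept positions are fixed: -3 at fixed
    points, normalised otherwise. *)
Lemma pf3_inj : {in [pred a | valid_arr a] &, injective (@pf3 n)}.
Proof.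
move=> a b /forallP va /forallP vb; rewrite !pf3E => /eq_in_map e.
have {}e i : pf3_letter a i = pf3_letter b i by apply: e; rewrite mem_enum.
have ek i : kept a i = kept b i by rewrite -!pf3_letter_gt0 e.
have erk x : rk (kept a) x = rk (kept b) x.
  by apply: eq_count => j /=; rewrite ek.
have e1 i : a.1 i = b.1 i.
  have := e i; rewrite /pf3_letter -ek; case: ifP => ki.
    move=> [] h; apply: (@rk_inj _ (kept b)); last by rewrite -erk.
      by rewrite -ek kept_perm.
    by rewrite kept_perm -ek.
  move=> _; move: (ki); rewrite {1}/kept => /negbFE/andP[/eqP-> _].
  by move: ki; rewrite ek /kept => /negbFE/andP[/eqP-> _].
have e2 i : a.2 i = b.2 i.
  have := e i; rewrite /pf3_letter -ek; case: ifP => ki; last by move=> /phival_inj.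
  move=> _; case: (eqVneq (a.1 i) i) => [fi|nfi]; last first.
    have /implyP/(_ nfi)/eqP -> := va i.
    by have := vb i; rewrite -e1 nfi => /eqP ->.
  apply: phival_inj; move: (ki); rewrite {1}/kept fi eqxx negbK => /eqP ->.
  by move: ki; rewrite ek /kept -e1 fi eqxx negbK => /eqP ->.
case: a b e1 e2 {va vb e ek erk} => [p1 f1] [p2 f2] /= e1 e2; congr pair.
  exact/permP.
exact/ffunP.
Qed.

(** These words form the image of [pf3] on valid arrangements. *)
Definition good_word (w : seq int) :=
  [/\ size w = n,
      all (fun x => [|| x == - 1, x == - 2 | 0 < x]) w &
      perm_eq [seq x <- w | 0 < x] [seq Posz k | k <- iota 1 (count (fun x => 0 < x) w)]].

Lemma pf3_good a : good_word (pf3 a).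
Proof.
rewrite /good_word pf3E size_map size_enum_ord; split=> //.
  rewrite all_map; apply/allP => i _ /=; rewrite pf3_letter_gt0 /pf3_letter.
  case: ifP => [|/negbFE/andP[_]]; first by rewrite !orbT.
  by case: (a.2 i) => [[|[|[|k]]] hk].
rewrite count_map filter_map (eq_count (a2 := kept a)); last exact: pf3_letter_gt0.
rewrite (eq_filter (a2 := kept a)); last exact: pf3_letter_gt0.
(* Reindexing by the values [a.1 i], which run over [kept a] again, makes [rk_perm] applicable. *)
rewrite (_ : [seq pf3_letter a i | i <- enum _ & kept a i] =
  [seq Posz k | k <- [seq rk (kept a) x | x : 'I_n <- [seq a.1 i | i <- enum 'I_n & kept a i]]]);
  last first.
  rewrite -!map_comp.
  apply/eq_in_map => i; rewrite mem_filter => /andP[ki _].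
  by rewrite /= /pf3_letter ki.
apply: perm_map; apply: perm_trans (rk_perm _); apply: perm_map.
have u : uniq [seq i <- enum 'I_n | kept a i] by exact/filter_uniq/enum_uniq.
apply: uniq_perm; rewrite ?(map_inj_uniq perm_inj) // => i.
by rewrite -[i](permKV a.1) (mem_map perm_inj) !(mem_filter (kept a)) !mem_enum kept_perm.
Qed.

(* The permutation [q] is recovered from the ranks: on the positive positions of [w], [q i] is the
   positive position whose rank among them is the letter [w_i]. *)
Lemma good_pf3 w : good_word w -> exists2 a : arrangement n, valid_arr a & pf3 a = w.
Proof.
case=> sw /allP aw pw.
pose wi (i : 'I_n) := nth 0 w i.
have wE : w = [seq wi i | i <- enum 'I_n].
  apply: (@eq_from_nth _ 0) => [|i iw]; first by rewrite size_map size_enum_ord.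
  rewrite sw in iw; rewrite (nth_map (Ordinal iw)) ?size_enum_ord //.
  by rewrite /wi nth_enum_ord.
pose K i := 0 < wi i.
have wiw i : wi i \in w by rewrite mem_nth ?sw.
have {}pw : perm_eq [seq wi i | i <- enum 'I_n & K i]
    [seq Posz k | k <- iota 1 (count K (enum 'I_n))].
  by move: pw; rewrite wE filter_map count_map.
have pk : perm_eq [seq wi i | i <- enum 'I_n & K i]
    [seq Posz (rk K x) | x : 'I_n <- [seq i <- enum 'I_n | K i]].
  by apply: (perm_trans pw); rewrite perm_sym (map_comp Posz) perm_map ?rk_perm.
have wi_inj i j : K i -> K j -> wi i = wi j -> i = j.
  move=> Ki Kj; have : uniq [seq wi i | i <- enum 'I_n & K i].
    rewrite (perm_uniq pw) map_inj_uniq ?iota_uniq //; by move=> ? ? [].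
  by move=> /uniq_map_inj; apply; rewrite mem_filter ?Ki ?Kj mem_enum.
have ex i : K i -> exists x, K x && (Posz (rk K x) == wi i).
  move=> Ki; have : wi i \in [seq wi i | i <- enum 'I_n & K i].
    by apply: map_f; rewrite mem_filter Ki mem_enum.
  rewrite (perm_mem pk) => /mapP[x]; rewrite mem_filter => /andP[Kx _] e.
  by exists x; rewrite Kx e /=.
(* The default is never reached on [K], since [ex] supplies a position. *)
pose q i := if K i then odflt i [pick x | K x && (Posz (rk K x) == wi i)] else i.
have qP i : K i -> K (q i) /\ Posz (rk K (q i)) = wi i.
  move=> Ki; rewrite /q Ki; case: pickP => [x /andP[Kx /eqP] //|h].
  by have [x] := ex i Ki; rewrite h.
have qN i : ~~ K i -> q i = i by rewrite /q => /negbTE->.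
have q_inj : injective q.
  move=> i j; case: (boolP (K i)) (boolP (K j)) => [Ki|Ki] [Kj|Kj].
  - move=> e; apply: wi_inj => //; have [_ <-] := qP _ Ki; have [_ <-] := qP _ Kj.
    by rewrite e.
  - by rewrite (qN j) // => e; have [] := qP _ Ki; rewrite e (negbTE Kj).
  - by rewrite (qN i) // => e; have [] := qP _ Kj; rewrite -e (negbTE Ki).
  - by rewrite !qN.
(* [ord_max] encodes -3 and [lift ord0 ord0] encodes -2; [ord0] is both the label -1 and the
   normalised value off the fixed points. *)
pose fi i : 'I_3 := if K i then (if q i == i then ord_max else ord0)
  else if wi i == - 1 then ord0 else lift ord0 ord0.
pose a : arrangement n := (perm q_inj, [ffun i => fi i]).
have aK i : kept a i = K i.
  rewrite /kept /= permE ffunE /fi; case: (boolP (K i)) => Ki.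
    by case: eqP.
  by rewrite qN // eqxx; case: ifP.
exists a.
  apply/forallP => i; rewrite /= permE ffunE /fi; apply/implyP => qi.
  by case: (boolP (K i)) => [_|/qN e]; [rewrite (negbTE qi) | rewrite e eqxx in qi].
rewrite pf3E wE; apply: eq_map => i; rewrite /pf3_letter aK.
case: (boolP (K i)) => Ki.
  rewrite /= permE; have [_ <-] := qP _ Ki; congr Posz.
  by apply: eq_count => j; rewrite aK.
rewrite ffunE /fi (negbTE Ki).
have := aw _ (wiw i); rewrite -/(K i) (negbTE Ki) orbF.
by case: eqP => [->|_] //= /eqP->.
Qed.

End PermutationForm.

(** * Enumeration of the words by content *)

(* [k] is the number of negative letters, [i] of which are equal to [-2]. *)
Definition contents n : seq (nat * nat) := [seq (k, i) | k <- iota 0 n.+1, i <- iota 0 k.+1].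

Definition words n : seq (seq int) :=
  [seq w | p <- contents n, w <- permutations (letters p.2 (p.1 - p.2) (n - p.1))].

Lemma mem_contents n k i : ((k, i) \in contents n) = (i <= k <= n).
Proof.
apply/allpairsPdep/idP => [[k' [i' [+ + [-> ->]]]]|]; rewrite ?mem_iota; first by lia.
by move=> h; exists k, i; rewrite !mem_iota; split=> //; lia.
Qed.

Lemma mem_wordsP n w : reflect (good_word n w) (w \in words n).
Proof.
apply: (iffP allpairsPdep) => [[[k i] [v [+ + ->]]]|[sw aw pw]].
  rewrite mem_contents mem_permutations /= => /andP[ik kn] pv.
  have posE : [seq x <- letters i (k - i) (n - k) | (0 < x)%R] =
      rev [seq Posz k0 | k0 <- iota 1 (n - k)].
    rewrite /letters !filter_cat filter_rev !filter_nseq /= !cats0; congr rev.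
    apply/all_filterP; rewrite all_map; apply/allP => x.
    by rewrite mem_iota => /andP[].
  have cnt : count (fun x : int => (0 < x)%R) v = n - k.
    by rewrite (seq.permP pv) -size_filter posE size_rev size_map size_iota.
  split.
  - rewrite (perm_size pv) /letters !size_cat !size_nseq size_rev size_map size_iota. lia.
  - rewrite (perm_all _ pv) /letters !all_cat all_rev !all_nseq /= !orbT !andbT all_map.
    by apply/allP => x; rewrite mem_iota /=; lia.
  - rewrite cnt; apply: (perm_trans (perm_filter _ pv)); rewrite posE.
    by rewrite perm_rev.
set c1 := count_mem (- 1)%R w; set c2 := count_mem (- 2)%R w.
have e : count (fun x : int => (0 < x)%R) w + c1 + c2 = n.
  rewrite -sw /c1 /c2; elim: (w) aw => //= x v IH /andP[xw /IH <-].
  by case/or3P: xw => [/eqP->|/eqP->|x0] //=; try lia.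
exists (c1 + c2, c2), w; split=> //; first by rewrite mem_contents; lia.
rewrite mem_permutations /= addnK
  (_ : n - (c1 + c2) = count (fun x : int => (0 < x)%R) w); last lia.
(* Splitting off the positive letters, and then separating -1 from -2, rearranges [w] into the
   blocks of [letters]. *)
apply: (@perm_trans _ ([seq x <- w | (0 < x)%R] ++ [seq x <- w | ~~ (0 < x)%R])).
  by rewrite perm_sym perm_filterC.
apply: perm_cat; first by rewrite perm_sym perm_rev perm_sym.
set v := [seq x <- w | _].
apply: (@perm_trans _ ([seq x <- v | x == - 1] ++ [seq x <- v | x != - 1])%R).
  by rewrite perm_sym perm_filterC.
have filter_eq (x : int) (P : pred int) : ~~ (0 < x)%R -> {in v, P =1 pred1 x} ->
    [seq y <- v | P y] = nseq (count_mem x w) x.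
  move=> x0 Px; rewrite (eq_in_filter Px).
  rewrite (_ : count_mem x w = size (filter (pred1 x) v)); last first.
    rewrite size_filter count_filter; apply: eq_count => y /=.
    by case: eqP => // ->; rewrite x0.
  by apply/all_pred1P/filter_all.
rewrite (filter_eq (- 1)%R) // (filter_eq (- 2)%R) // => x.
rewrite mem_filter => /andP[x0 /(allP aw)]; rewrite (negbTE x0) orbF /=.
by case/orP => /eqP->.
Qed.

Lemma count_letters i j m : count_mem (- 1)%R (letters i j m) = j /\
  count_mem (- 2)%R (letters i j m) = i.
Proof.
have c0 (x : int) : (x < 0)%R -> count_mem x (rev [seq Posz k | k <- iota 1 m]) = 0.
  move=> x0; rewrite count_rev; apply/count_memPn/mapP => -[k _ e].
  by rewrite e in x0.
by rewrite /letters !count_cat !c0 // !count_nseq /= !mul1n !mul0n !add0n addn0.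
Qed.

(** The multiplicities of -1 and -2 in a word determine its content, so blocks of different contents
    are disjoint. *)
Lemma uniq_words n : uniq (words n).
Proof.
apply: allpairs_uniq_dep => [|p _|].
- apply: allpairs_uniq_dep; [exact: iota_uniq|by move=> *; exact: iota_uniq|].
  by move=> [x t] [y u] _ _ /= [-> ->].
- exact: permutations_uniq.
move=> p q /allpairsPdep[[k1 i1] [v1 [+ + ->]]] /allpairsPdep[[k2 i2] [v2 [+ + ->]]] /= e.
rewrite -{}e !mem_contents !mem_permutations /= => /andP[ik1 _] /seq.permP p1
  /andP[ik2 _] /seq.permP p2.
have := count_letters i2 (k2 - i2) (n - k2); have := count_letters i1 (k1 - i1) (n - k1).
rewrite -!p1 -!p2 => -[c1 d1] [c2 d2].
have ei : i1 = i2 by rewrite -d1.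
have ek : k1 = k2 by rewrite -(subnK ik1) -(subnK ik2) -c1 -c2 ei.
by rewrite ei ek.
Qed.

Theorem theorem4p1 (n : nat) (s : 'S_3) : 1 <= n ->
  #|[pred a : arrangement n | valid_arr a && avoids (pf3 a) s]|
    = catalan n.+2 - 2 ^ n.
Proof.
move=> _; rewrite -grand_total_catalan.
have pw : perm_eq [seq pf3 a | a <- enum [pred a : arrangement n | valid_arr a]] (words n).
  apply: uniq_perm; [|exact: uniq_words|].
    rewrite map_inj_in_uniq ?enum_uniq // => a b; rewrite !mem_enum; exact: pf3_inj.
  move=> w; apply/mapP/mem_wordsP => [[a _ ->]|/good_pf3[a va <-]].
    exact: pf3_good.
  by exists a; rewrite ?mem_enum.
transitivity (count (avoids^~ s) (words n)).
  rewrite -(seq.permP pw) count_map -size_filter cardE; congr size.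
  rewrite /enum_mem -filter_predI; apply: eq_filter => a.
  by rewrite /= !inE andbC.
rewrite /words count_flatten sumnE !big_map.
(* Each content contributes its initial state, with no letter above the minimum, and this number
   does not depend on [s]. *)
transitivity (\sum_(p <- contents n) content_count p.2 (p.1 - p.2) (n - p.1) 0).
  apply: eq_big_seq => -[k i]; rewrite mem_contents => /andP[ik kn] /=.
  by rewrite map_id count_avoids /content_count /state_count addn0.
rewrite /contents big_allpairs_dep.
rewrite /grand_total -(big_mkord xpredT (fun k => neg_sum (n - k) 0 k)) /index_iota subn0.
apply: eq_bigr => k _.
by rewrite /neg_sum -(big_mkord xpredT (fun i => content_count i (k - i) (n - k) 0))
  /index_iota subn0.
Qed.
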